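(* Let $n\ge1$ and let $\beta<n+2$ be fixed. Let $s\in\mathbb{R}$, $s'=s+\max\{0,\beta-n\}$, and let $\mathbf b\in\mathcal H^s(\mathbf T^n)$ satisfy $\widehat{\mathbf b}_0=\mathbf 0$. Let $\mathbf u^{\mathcal N}\in\mathcal H^{s+2}(\mathbf T^n)$ be the solution of the Navier equation $\mathcal N\mathbf u^{\mathcal N}=\mathbf b$ with $\widehat{\mathbf u}^{\mathcal N}_0=\mathbf 0$, and for $\delta>0$ let $\mathbf u^{\delta,\beta}\in\mathcal H^{s'}(\mathbf T^n)$ be the solution of $\mathcal L^{\delta,\beta}\mathbf u=\mathbf b$ with $\widehat{\mathbf u}^{\delta,\beta}_0=\mathbf 0$. Then $$\lim_{\delta\to0^+}\mathbf u^{\delta,\beta}=\mathbf u^{\mathcal N}\quad\text{in }\mathcal H^{s'}(\mathbf T^n).$$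
   Context: Torus and spaces: $\mathbf T^n=\prod_{i=1}^n[0,2\pi]$ with periodic identification; a periodic vector distribution $\mathbf g$ is written $\mathbf g=\sum_{k\in\mathbb{Z}^n}\widehat{\mathbf g}_k e^{ik\cdot x}$ with Fourier coefficients $\widehat{\mathbf g}_k\in\mathbb{C}^n$. For $q\in\mathbb{R}$, $\mathcal H^q(\mathbf T^n)$ is the space of periodic vector distributions with $\|\mathbf g\|^2_{\mathcal H^q}=\sum_k(1+\|k\|^2)^q\|\widehat{\mathbf g}_k\|^2<\infty$. Multipliers: with ${}_pF_q(a_1,\dots,a_p;b_1,\dots,b_q;x)=\sum_{m\ge0}\frac{(a_1)_m\cdots(a_p)_m}{(b_1)_m\cdots(b_q)_m}\frac{x^m}{m!}$, where $(a)_m=a(a+1)\cdots(a+m-1)$, set for $\nu\in\mathbb{R}^n$ $$\lambda_1(\nu)=-\|\nu\|^2\Big(3\mu\,{}_3F_4\big(1,\tfrac52,\tfrac{n+2-\beta}{2};2,\tfrac32,\tfrac{n+4}{2},\tfrac{n+4-\beta}{2};-\tfrac14\|\nu\|^2\delta^2\big)+(\lambda^*-\mu)\,{}_1F_2\big(\tfrac{n+2-\beta}{2};\tfrac{n+2}{2},\tfrac{n+4-\beta}{2};-\tfrac14\|\nu\|^2\delta^2\big)^2\Big),$$ $$\lambda_2(\nu)=-\mu\|\nu\|^2\,{}_2F_3\big(1,\tfrac{n+2-\beta}{2};2,\tfrac{n+4}{2},\tfrac{n+4-\beta}{2};-\tfrac14\|\nu\|^2\delta^2\big).$$ $M^{\delta,\beta}(\nu)$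 is the real symmetric $n\times n$ matrix with $M^{\delta,\beta}(\nu)\nu=\lambda_1(\nu)\nu$ and $M^{\delta,\beta}(\nu)w=\lambda_2(\nu)w$ for $w\perp\nu$; $M^{\delta,\beta}(0)=0$. Write $M_k=M^{\delta,\beta}(k)$. Operators: the linear state-based peridynamic operator acts by $\mathcal L^{\delta,\beta}\mathbf u=\sum_{k\in\mathbb{Z}^n}M_k\widehat{\mathbf u}_ke^{ik\cdot x}$. The Navier operator $\mathcal N\mathbf u=(\lambda^*+\mu)\nabla(\nabla\cdot\mathbf u)+\mu\Delta\mathbf u$ acts by $\mathcal N\mathbf u=\sum_kM^{\mathcal N}_k\widehat{\mathbf u}_ke^{ik\cdot x}$ with $M^{\mathcal N}_k=-(\lambda^*+\mu)k\otimes k-\mu\|k\|^2I$. Standing assumption: the Lamé parameters satisfy $\mu>0$, $\lambda^*+2\mu>0$ (so the Navier equation is solvable), and are such that $\lambda_1(\nu)<0$ for all $\nu\ne0$ and all parameter values under consideration (and $\lambda_2(\nu)<0$ for all $\nu\neq 0$). *)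

(* Defs.v *)
From HB Require Import structures.
From mathcomp Require Export all_boot all_order all_algebra.
From mathcomp Require Export complex.
From mathcomp Require Export all_classical all_reals all_analysis.

Set Implicit Arguments.
Unset Strict Implicit.
Unset Printing Implicit Defensive.

Export Order.TTheory GRing.Theory Num.Theory.
Export numFieldNormedType.Exports.

Local Open Scope classical_set_scope.
Local Open Scope ring_scope.

Section Hypergeometric.
Variable R : realType.

Definition poch (a : R) (m : nat) : R := \prod_(i < m) (a + i%:R).

Definition hypergeom_coeff (a b : seq R) (m : nat) : R :=
  (\prod_(c <- a) poch c m) / (\prod_(c <- b) poch c m) / m`!%:R.

(* The value is meaningful when no entry of [b] is a nonpositive integer and
   the series converges; for [size a <= size b] it converges for every [x]. *)
Definition hypergeom (a b : seq R) (x : R) : R :=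
  limn (series (fun m => hypergeom_coeff a b m * x ^+ m)).

End Hypergeometric.

Section Vectors.
Variables (R : realType) (n : nat).

Definition normsq (v : 'cV[R]_n) : R := \sum_(i < n) v i 0 ^+ 2.

Definition cnormsq (v : 'cV[R[i]]_n) : R :=
  \sum_(i < n) (complex.Re (v i 0) ^+ 2 + complex.Im (v i 0) ^+ 2).

Definition freq (k : 'cV[int]_n) : 'cV[R]_n := map_mx intr k.

Lemma dot_normsq (nu : 'cV[R]_n) : nu^T *m nu = (normsq nu)%:M.
Proof.
rewrite [LHS]mx11_scalar !mxE; congr (_%:M).
by apply: eq_bigr => i _; rewrite !mxE expr2.
Qed.

Lemma normsq_eq0 (nu : 'cV[R]_n) : (normsq nu == 0) = (nu == 0).
Proof.
rewrite /normsq psumr_eq0; last by move=> i _; exact: sqr_ge0.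
apply/allP/eqP => [h|-> i _]; last by rewrite mxE expr0n /=.
apply/colP => i; rewrite mxE; apply/eqP; rewrite -sqrf_eq0.
by apply: (h i); rewrite mem_index_enum.
Qed.

End Vectors.

Arguments freq R {n} k.

Section Multipliers.
Variables (R : realType) (n : nat) (mu lams delta beta : R).
Implicit Types nu w : 'cV[R]_n.

Definition lambda1 nu : R :=
  let x := - (4^-1 * normsq nu * delta ^+ 2) in
  let a := (n%:R + 2 - beta) / 2 in
  let c := (n%:R + 4 - beta) / 2 in
  - normsq nu *
    (3 * mu * hypergeom [:: 1; 5 / 2; a] [:: 2; 3 / 2; (n%:R + 4) / 2; c] x
     + (lams - mu) * hypergeom [:: a] [:: (n%:R + 2) / 2; c] x ^+ 2).

Definition lambda2 nu : R :=
  let x := - (4^-1 * normsq nu * delta ^+ 2) in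
  let a := (n%:R + 2 - beta) / 2 in
  let c := (n%:R + 4 - beta) / 2 in
  - mu * normsq nu * hypergeom [:: 1; a] [:: 2; (n%:R + 4) / 2; c] x.

Definition is_peri_multiplier nu (A : 'M[R]_n) : Prop :=
  [/\ A^T = A,
      A *m nu = lambda1 nu *: nu,
      forall w, nu^T *m w = 0 -> A *m w = lambda2 nu *: w
    & nu = 0 -> A = 0].

(* "the matrix such that": existence and uniqueness are [peri_multiplierP]. *)
Definition peri_multiplier nu : 'M[R]_n := xget 0 (is_peri_multiplier nu).

Definition peri_multiplier_formula nu : 'M[R]_n :=
  (lambda2 nu)%:M + ((lambda1 nu - lambda2 nu) / normsq nu) *: (nu *m nu^T).

Lemma peri_multiplier_formulaP nu :
  is_peri_multiplier nu (peri_multiplier_formula nu).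
Proof.
rewrite /is_peri_multiplier /peri_multiplier_formula; split.
- by rewrite linearD linearZ /= tr_scalar_mx trmx_mul trmxK.
- rewrite mulmxDl mul_scalar_mx -scalemxAl -mulmxA dot_normsq mul_mx_scalar.
  have [->|nu0] := eqVneq nu 0; first by rewrite !scaler0 addr0.
  rewrite scalerA divfK ?normsq_eq0// -scalerDl.
  by rewrite addrC subrK.
- move=> w nuw.
  by rewrite mulmxDl mul_scalar_mx -scalemxAl -mulmxA nuw mulmx0 scaler0 addr0.
- move=> ->; rewrite mul0mx scaler0 addr0 /lambda2.
  have -> : @normsq R n 0 = 0 by apply/eqP; rewrite normsq_eq0.
  by rewrite mulr0 mul0r; apply/matrixP => i j; rewrite !mxE mul0rn.
Qed.

Lemma is_peri_multiplier_uniq nu A B :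
  is_peri_multiplier nu A -> is_peri_multiplier nu B -> A = B.
Proof.
have ext C D : (forall x : 'cV[R]_n, C *m x = D *m x) -> C = D :> 'M[R]_n.
  move=> h; apply/matrixP => i j.
  have /colP/(_ i) := h (delta_mx j 0).
  by rewrite -!colE !mxE.
case=> _ A1 A2 A0 [_ B1 B2 B0].
have [nu0|nu0] := eqVneq nu 0; first by rewrite A0// B0.
apply: ext => x; set c := (nu^T *m x) 0 0 / normsq nu.
have orth : nu^T *m (x - c *: nu) = 0.
  rewrite mulmxBr -scalemxAr dot_normsq scale_scalar_mx [nu^T *m x]mx11_scalar.
  by rewrite /c divfK ?normsq_eq0// subrr.
rewrite -[x](subrK (c *: nu)); move: (x - _) orth => w orth.
by rewrite !mulmxDr A2// B2// -!scalemxAr A1 B1.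
Qed.

Lemma peri_multiplierP nu A :
  is_peri_multiplier nu A <-> A = peri_multiplier nu.
Proof.
have ok : is_peri_multiplier nu (peri_multiplier nu).
  by apply: xgetPex; exists (peri_multiplier_formula nu);
     exact: peri_multiplier_formulaP.
by split=> [hA|-> //]; exact: (is_peri_multiplier_uniq hA ok).
Qed.

Lemma peri_multiplierE nu :
  peri_multiplier nu = peri_multiplier_formula nu.
Proof. by apply/esym/peri_multiplierP/peri_multiplier_formulaP. Qed.

End Multipliers.

Section Distributions.
Variables (R : realType) (n : nat).

(* A formal Fourier series, given by its coefficients; it is a periodic
   distribution exactly when the coefficients grow at most polynomially. *)
Definition fourier_scalar : Type := 'cV[int]_n -> R[i].
Definition fourier_vector : Type := 'cV[int]_n -> 'cV[R[i]]_n.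

Implicit Types g u : fourier_vector.

Definition periodic_distribution g : Prop :=
  exists (C : R) (N : nat), forall k : 'cV[int]_n,
    Num.sqrt (cnormsq (g k)) <= C * (1 + Num.sqrt (normsq (freq R k))) ^+ N.

Definition sobolev_norm (q : R) g : \bar R :=
  sqrte (\esum_(k in [set: 'cV[int]_n])
           ((1 + normsq (freq R k)) `^ q * cnormsq (g k))%:E).

Definition sobolev (q : R) : set fourier_vector :=
  [set g | periodic_distribution g /\ (sobolev_norm q g < +oo)%E].

Definition real_cmx (m p : nat) (A : 'M[R]_(m, p)) : 'M[R[i]]_(m, p) :=
  map_mx (fun x : R => Complex x 0) A.

Definition peridynamic (mu lams delta beta : R) u : fourier_vector :=
  fun k => real_cmx (peri_multiplier mu lams delta beta (freq R k)) *m u k.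

(* On Fourier coefficients, the derivative along the j-th axis multiplies by i k_j. *)
Definition pderiv (j : 'I_n) (f : fourier_scalar) : fourier_scalar :=
  fun k => Complex 0 (freq R k j 0) * f k.

Definition divergence u : fourier_scalar :=
  fun k => \sum_(j < n) pderiv j (fun l => u l j 0) k.

Definition gradient (f : fourier_scalar) : fourier_vector :=
  fun k => \col_j pderiv j f k.

Definition laplacian u : fourier_vector :=
  fun k => \col_i \sum_(j < n) pderiv j (pderiv j (fun l => u l i 0)) k.

Definition navier (mu lams : R) u : fourier_vector := fun k =>
  Complex (lams + mu) 0 *: gradient (divergence u) k
  + Complex mu 0 *: laplacian u k.

Definition navier_multiplier (mu lams : R) (k : 'cV[int]_n) : 'M[R]_n :=
  - ((lams + mu) *: (freq R k *m (freq R k)^T))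
  - (mu * normsq (freq R k))%:M.

Lemma navierE (mu lams : R) u k :
  navier mu lams u k = real_cmx (navier_multiplier mu lams k) *m u k.
Proof.
have CR (x : R) : Complex x 0 = real_complex R x by [].
have I2 (x y : R) : Complex 0 x * Complex 0 y = real_complex R (- (x * y)).
  by apply/eqP; rewrite eq_complex /= !mul0r !mulr0 sub0r addr0 !eqxx.
pose K j := freq R k j 0; apply/colP => i.
have E1 : pderiv i (divergence u) k =
    \sum_j real_complex R (- (K i * K j)) * u k j 0.
  rewrite /divergence /pderiv mulr_sumr; apply: eq_bigr => j _.
  by rewrite mulrA I2.
have E2 : \sum_j pderiv j (pderiv j (fun l => u l i 0)) k =
    real_complex R (- normsq (freq R k)) * u k i 0.
  rewrite /normsq -sumrN raddf_sum mulr_suml; apply: eq_bigr => j _.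
  by rewrite /pderiv mulrA I2 expr2.
have E3 j : real_cmx (navier_multiplier mu lams k) i j =
    real_complex R ((lams + mu) * - (K i * K j))
    + real_complex R (mu * - normsq (freq R k)) *+ (i == j).
  rewrite -rmorphMn -rmorphD !mxE big_ord1 [(freq R k)^T _ _]mxE CR.
  by rewrite !mulrN mulNrn /K !mxE.
rewrite /navier !mxE E1 E2 !CR.
under [RHS]eq_bigr => j _ do rewrite E3 mulrDl.
rewrite big_split /= mulr_sumr; congr (_ + _).
  by apply: eq_bigr => j _; rewrite mulrA -rmorphM.
rewrite (bigD1 i)//= big1 ?addr0 => [|j /negPf ji]; last first.
  by rewrite eq_sym ji mulr0n mul0r.
by rewrite eqxx mulr1n mulrA -rmorphM.
Qed.

End Distributions.

(* Main.v *)
Require Import Defs.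
From mathcomp Require Import ring lra.

(** On Fourier modes both equations are diagonal with respect to the splitting
of C^n into the line of k and its orthogonal, so that u^delta - u^N is obtained
from b, mode by mode, by the differences of the inverse eigenvalues. For a fixed
k these differences tend to 0, because the hypergeometric factors are continuous
with value 1 at 0. The theorem is then dominated convergence for sums over k
([esum_dominated]), and the whole difficulty is the dominating sequence: the
peridynamic eigenvalues lose ellipticity at high frequency, and one needs
|lambda_i(k)| >= c (1 + |k|^2)^(max(0, beta - n) / 2) uniformly in delta <= 1,
which is exactly what the shift from s to s' absorbs ([gap_bounded]).

Write t = |k|^2 delta^2 / 4, a = (n + 2 - beta) / 2, b = (n + 2) / 2 and
p = min(1, a), so that 2 - 2 p = max(0, beta - n). The eigenvalues are
- |k|^2 L(t) and - |k|^2 T(t) for two entire functions L and T of t, and since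
t <= |k|^2 it suffices that L and T are at least c (1 + t)^(- p) on t >= 0
([symbols_coercive]). They are positive by hypothesis, so by compactness only
t -> +oo matters, and there the asymptotics are obtained without Gamma
functions or contour integrals, from first order equations:

- h(t) = 0F1(; b; - t), a rescaled Bessel function, solves t h'' + b h' + h = 0;
  an exact nonincreasing energy gives h = O(t^(-1/2)) and h' = O(t^(-1))
  ([bessel_energy]);
- f = 1F2 satisfies (t^a f)' = a t^(a-1) h; one integration by parts gives
  f^2 = o(t^(- p)) ([F12_decay]), so the term whose coefficient lams - mu may
  have either sign is negligible;
- q = 2F3 satisfies (t^a q)' = a b t^(a-2) (1 - h), whose right-hand side is
  eventually comparable to t^(a-2); integrating, q >= c t^(- p) ([F23_lower]);
- g = 3F4 is an explicit combination of q and h, which inherits that bound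
  ([F34_lower]). *)

Set Implicit Arguments.
Unset Strict Implicit.
Unset Printing Implicit Defensive.

Local Open Scope classical_set_scope.
Local Open Scope ring_scope.

(** * Entire power series *)

Section PowerSeries.
Variable R : realType.
Implicit Types (c d : nat -> R) (a t : R).

(** The factorial gain makes the class stable under termwise differentiation,
since the factor m + 1 is absorbed by the factorial; all the series below are in
it, hence entire and infinitely differentiable. *)
Definition fact_bounded c := exists C : R, forall m, `|c m| <= C / m`!%:R.

Definition shift c : nat -> R := fun m => c m.+1.

Definition psum c t : R := limn (pseries c t).

Lemma fact_bounded_diffs c : fact_bounded c -> fact_bounded (pseries_diffs c).
Proof.
move=> [C hC]; exists C => m; rewrite /pseries_diffs normrM ger0_norm//.
rewrite -ler_pdivlMl ?ltr0n//; apply: (le_trans (hC _)).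
by rewrite factS natrM invfM mulrCA.
Qed.

Lemma fact_bounded_ge0 c C : (forall m, `|c m| <= C / m`!%:R) -> 0 <= C.
Proof. by move=> /(_ 0%N); rewrite fact0 divr1; apply: le_trans. Qed.

Lemma fact_bounded_shift c : fact_bounded c -> fact_bounded (shift c).
Proof.
move=> [C hC]; exists C => m; apply: (le_trans (hC _)).
rewrite ler_wpM2l ?(fact_bounded_ge0 hC)//.
rewrite lef_pV2 ?posrE ?ltr0n ?fact_gt0// ler_nat factS.
by rewrite leq_pmull.
Qed.

Lemma fact_boundedZ a c : fact_bounded c -> fact_bounded (fun m => a * c m).
Proof.
move=> [C hC]; exists (`|a| * C) => m.
by rewrite normrM -mulrA ler_wpM2l.
Qed.

Lemma fact_boundedD c d : fact_bounded c -> fact_bounded d ->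
  fact_bounded (fun m => c m + d m).
Proof.
move=> [C hC] [D hD]; exists (C + D) => m.
by rewrite mulrDl (le_trans (ler_normD _ _))// lerD.
Qed.

Lemma fact_bounded_div a c d : 0 < a -> fact_bounded d ->
  (forall m, (m%:R + a) * c m = d m) -> fact_bounded c.
Proof.
move=> a0 [D hD] cd; exists (D / a) => m.
rewrite mulrAC ler_pdivlMr//; apply: le_trans (hD m).
rewrite -cd normrM mulrC ler_wpM2r// ger0_norm ?addr_ge0 ?(ltW a0)//.
by rewrite lerDr.
Qed.

Lemma cvg_fact_bounded c t : fact_bounded c -> cvgn (pseries c t).
Proof.
move=> [C hC]; apply: normed_cvg => /=.
apply: (@series_le_cvg _ _ (fun m => C * exp_coeff `|t| m)) => [m|m|m|] /=.
- exact: normr_ge0.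
- by rewrite mulr_ge0 ?(fact_bounded_ge0 hC)// divr_ge0// exprn_ge0.
- by rewrite normrM normrX /exp_coeff/= mulrCA mulrC ler_wpM2l ?exprn_ge0.
- exact/is_cvg_seriesZ/is_cvg_series_exp_coeff.
Qed.

Lemma is_derive_psum c t : fact_bounded c ->
  is_derive t (1 : R) (psum c) (psum (pseries_diffs c) t).
Proof.
move=> hc; apply: (@pseries_snd_diffs _ c (`|t| + 1)).
- exact: cvg_fact_bounded.
- exact/cvg_fact_bounded/fact_bounded_diffs.
- exact/cvg_fact_bounded/fact_bounded_diffs/fact_bounded_diffs.
- by rewrite [ltRHS]ger0_norm ?addr_ge0// ltrDl.
Qed.

Lemma continuous_psum c : fact_bounded c -> continuous (psum c).
Proof.
move=> hc t; apply/differentiable_continuous/derivable1_diffP.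
by case: (is_derive_psum t hc).
Qed.

Lemma psum_shift c t : fact_bounded c -> psum c t = c 0 + t * psum (shift c) t.
Proof.
move=> hc; apply/cvg_lim => //; rewrite -cvg_shiftS /=.
have -> : (fun m => pseries c t m.+1) = (fun m => c 0 + t * pseries (shift c) t m).
  apply/funext => m; rewrite /pseries /series /= big_nat_recl//= expr0 mulr1.
  congr (_ + _); rewrite mulr_sumr; apply: eq_bigr => i _.
  by rewrite exprS mulrCA.
apply: cvgD; first exact: cvg_cst.
apply: cvgM; first exact: cvg_cst.
exact/cvg_fact_bounded/fact_bounded_shift.
Qed.

Lemma psumZ a c t : fact_bounded c -> psum (fun m => a * c m) t = a * psum c t.
Proof.
move=> hc; apply/cvg_lim => //.
have -> : pseries (fun m => a * c m) t = (fun m => a * pseries c t m).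
  apply/funext => m; rewrite /pseries /series /= mulr_sumr.
  by apply: eq_bigr => i _; rewrite mulrA.
apply: cvgM; first exact: cvg_cst.
exact/cvg_fact_bounded.
Qed.

Lemma psumD c d t : fact_bounded c -> fact_bounded d ->
  psum (fun m => c m + d m) t = psum c t + psum d t.
Proof.
move=> hc hd; apply/cvg_lim => //.
have -> : pseries (fun m => c m + d m) t = (fun m => pseries c t m + pseries d t m).
  apply/funext => m; rewrite /pseries /series /= -big_split /=.
  by apply: eq_bigr => i _; rewrite mulrDl.
by apply: cvgD; apply: cvg_fact_bounded.
Qed.

Lemma psum0 c : psum c 0 = c 0.
Proof.
apply/cvg_lim => //; rewrite -cvg_shiftS /=.
have -> : (fun m => pseries c 0 m.+1) = (fun m => c 0).
  apply/funext => m; rewrite /pseries /series /= big_nat_recl//= expr0 mulr1.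
  by rewrite big1 ?addr0// => i _; rewrite expr0n mulr0.
exact: cvg_cst.
Qed.

(** Termwise, t d/dt multiplies the m-th coefficient by m: any relation
(m + a) c_m = d_m between coefficients is a first order differential equation
between the sums. Every differential equation used below arises this way. *)
Lemma psum_euler a c d t : fact_bounded c -> fact_bounded d ->
  (forall m, (m%:R + a) * c m = d m) ->
  t * psum (pseries_diffs c) t + a * psum c t = psum d t.
Proof.
move=> hc hd cd; rewrite (psum_shift _ hc) (psum_shift _ hd) -cd add0r.
have -> : shift d = (fun m => pseries_diffs c m + a * shift c m).
  by apply/funext => m; rewrite /shift -cd mulrDl.
have hc' := fact_bounded_shift hc.
rewrite psumD; [|exact: fact_bounded_diffs|exact: fact_boundedZ].
by rewrite psumZ//; ring.
Qed.

End PowerSeries.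

(** * The Bessel equation *)

Section Deriv.
Variable R : realType.
Implicit Types (f g : R -> R) (x df dg : R).

(** The derivation rules in pointwise form, so that derivatives of explicit
expressions are assembled as terms. *)
Lemma is_derive_addf f g x df dg : is_derive x (1 : R) f df ->
  is_derive x (1 : R) g dg -> is_derive x (1 : R) (fun t => f t + g t) (df + dg).
Proof. by move=> hf hg; exact: is_deriveD. Qed.

Lemma is_derive_mulf f g x df dg : is_derive x (1 : R) f df ->
  is_derive x (1 : R) g dg ->
  is_derive x (1 : R) (fun t => f t * g t) (f x * dg + df * g x).
Proof.
move=> hf hg; apply: (is_derive_eq (is_deriveM hf hg)).
by rewrite /GRing.scale /= [df * _]mulrC.
Qed.

Lemma is_derive_cstf (c x : R) : is_derive x (1 : R) (fun=> c) 0.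
Proof. exact: is_derive_cst. Qed.

Lemma is_derive_idf x : is_derive x (1 : R) (fun t => t) 1.
Proof. exact: is_derive_id. Qed.

Lemma nondecreasing_of_derive f (f' : R -> R) (a : R) :
  (forall x, a <= x -> is_derive x (1 : R) f (f' x)) ->
  (forall x, a <= x -> 0 <= f' x) ->
  forall x y, a <= x -> x <= y -> f x <= f y.
Proof.
move=> hf f'0; have lt_le x : x \in `]a, +oo[ -> a <= x.
  by rewrite in_itv/= andbT; apply: ltW.
apply: ger0_derive1_ndecry => [x /lt_le ax|x /lt_le ax|].
- by case: (hf x ax).
- by rewrite derive1E; case: (hf x ax) => _ ->; exact: f'0.
- apply: continuous_in_subspaceT => x; rewrite inE/= in_itv/= andbT => ax.
  by apply/differentiable_continuous/derivable1_diffP; case: (hf x ax).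
Qed.

End Deriv.

Section Bessel.
Variables (R : realType) (b : R) (h h1 h2 : R -> R).
Hypothesis b32 : 3 / 2 <= b.
Hypothesis dh : forall t, is_derive t (1 : R) h (h1 t).
Hypothesis dh1 : forall t, is_derive t (1 : R) h1 (h2 t).
Hypothesis ode : forall t, t * h2 t + b * h1 t = - h t.
Hypothesis h0 : h 0 = 1.

(** In the variable r = 2 sqrt t, the first two terms are the energy
(r h)'^2 + (r h)^2 of the amplitude r h, whose derivative in t is
- (2 b - 3) (2 h h' + 4 t h'^2). The term (2 b - 3) h^2 cancels the part without
a sign, and the derivative of the sum is - 4 (2 b - 3) t h'^2. The value at 0
is 2 b - 2. *)
Lemma bessel_energy t : 0 <= t ->
  (h t + 2 * (t * h1 t)) ^+ 2 + 4 * (t * h t ^+ 2) + (2 * b - 3) * h t ^+ 2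
    <= 2 * b - 2.
Proof.
move=> t0.
pose w x := h x + 2 * (x * h1 x).
pose W x := - (w x * w x + 4 * (x * (h x * h x)) + (2 * b - 3) * (h x * h x)).
have dw x : is_derive x (1 : R) w
    (h1 x + (2 * (x * h2 x + 1 * h1 x) + 0 * (x * h1 x))).
  exact: (is_derive_addf (dh x) (is_derive_mulf (is_derive_cstf 2 x)
    (is_derive_mulf (is_derive_idf x) (dh1 x)))).
have dW x : is_derive x (1 : R) W ((2 * b - 3) * (4 * (x * h1 x ^+ 2))).
  have hh := is_derive_mulf (dh x) (dh x).
  have H := is_derive_addf (is_derive_addf (is_derive_mulf (dw x) (dw x))
    (is_derive_mulf (is_derive_cstf 4 x) (is_derive_mulf (is_derive_idf x) hh)))
    (is_derive_mulf (is_derive_cstf (2 * b - 3) x) hh).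
  apply: (is_derive_eq (is_deriveN H)); rewrite /w.
  have -> : x * h2 x = - h x - b * h1 x by rewrite -ode addrK.
  by ring.
have dW0 x : 0 <= x -> 0 <= (2 * b - 3) * (4 * (x * h1 x ^+ 2)).
  move=> x0; have b3 : 0 <= 2 * b - 3 by move: b32; lra.
  by rewrite mulr_ge0// mulr_ge0// mulr_ge0// sqr_ge0.
have := nondecreasing_of_derive (fun x _ => dW x) dW0 (lexx 0) t0.
by rewrite /W /w h0 !mul0r !mulr0 !mulr1 !addr0 !expr2; lra.
Qed.

Lemma bessel_decay t : 0 <= t -> 4 * (t * h t ^+ 2) <= 2 * b - 2.
Proof.
move=> /bessel_energy H; have := sqr_ge0 (h t + 2 * (t * h1 t)).
have : 0 <= (2 * b - 3) * h t ^+ 2 by rewrite mulr_ge0 ?sqr_ge0//; move: b32; lra.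
move: H; lra.
Qed.

(** From t >= 1 on, h is bounded by the decay estimate, and the energy then
controls 2 t h' = (h + 2 t h') - h. *)
Lemma bessel_derive_decay t : 1 <= t -> `|t * h1 t| <= b.
Proof.
move=> t1; have t0 : 0 <= t by apply: le_trans t1.
have H1 := bessel_decay t0; have H2 := bessel_energy t0.
have H3 : 0 <= (2 * b - 3) * h t ^+ 2.
  by rewrite mulr_ge0 ?sqr_ge0//; move: b32; lra.
have H4 : 0 <= (t - 1) * h t ^+ 2 by rewrite mulr_ge0 ?sqr_ge0// subr_ge0.
have H5 : 0 <= t * h t ^+ 2 by rewrite mulr_ge0 ?sqr_ge0.
rewrite -ler_sqr ?nnegrE//; last by move: b32; lra.
rewrite real_normK ?num_real//.
have := sqr_ge0 (b - 3/2); have := sqr_ge0 (2 * h t + 2 * (t * h1 t)).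
move: H1 H2 H3 H4 H5; set z := t * h1 t; set y := h t.
nra.
Qed.

Lemma bessel_small (e : R) : 0 < e ->
  exists2 T, 1 <= T & forall t, T <= t -> `|h t| <= e.
Proof.
move=> e0; exists (1 + b / e ^+ 2).
  by rewrite lerDl divr_ge0 ?sqr_ge0//; move: b32; lra.
move=> t Tt.
have e2 : 0 < e ^+ 2 by rewrite exprn_gt0.
have tb : b <= t * e ^+ 2.
  by rewrite -ler_pdivrMr//; apply: le_trans Tt; rewrite lerDr.
have t0 : 0 < t.
  by apply: lt_le_trans Tt; rewrite ltr_pwDl// divr_ge0 ?sqr_ge0//; move: b32; lra.
rewrite -ler_sqr ?nnegrE ?(ltW e0)// real_normK ?num_real//.
rewrite -(ler_pM2l t0); have := bessel_decay (ltW t0); move: b32 tb; lra.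
Qed.

End Bessel.

(** * Hypergeometric functions at minus infinity *)

Section PowerGrowth.
Variable R : realType.
Implicit Types (s t K M : R).

Lemma powR_succ t s : 0 < t -> t `^ s = t * t `^ (s - 1).
Proof.
move=> t0; rewrite -[X in X * _](powRr1 (ltW t0)) -powRD ?(gt_eqF t0) ?implybT//.
by rewrite addrC subrK.
Qed.

Lemma powR_eventually_ge s M : 0 < s ->
  exists2 T, 1 <= T & forall t, T <= t -> M <= t `^ s.
Proof.
move=> s0; exists (1 + `|M| `^ s^-1); first by rewrite lerDl powR_ge0.
move=> t Tt; have tM : `|M| `^ s^-1 <= t by apply: le_trans Tt; rewrite lerDr.
apply: (le_trans (ler_norm M)).
rewrite -[leLHS]powRr1// -(mulVf (lt0r_neq0 s0)) powRrM.
by rewrite ge0_ler_powR ?nnegrE ?powR_ge0 ?(ltW s0)// (le_trans _ tM)// powR_ge0.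
Qed.

(** Integration of a power bound, phrased without integrals: both
K / s * t^s + phi and K / s * t^s - phi are nondecreasing. The constant of
integration is absorbed because t^s >= 1 on t >= 1. *)
Lemma derive_growth (phi phi' : R -> R) s K : 0 < s ->
  (forall t, 1 <= t -> is_derive t (1 : R) phi (phi' t)) ->
  (forall t, 1 <= t -> `|phi' t| <= K * t `^ (s - 1)) ->
  exists2 M, 0 <= M & forall t, 1 <= t -> `|phi t| <= M * t `^ s.
Proof.
move=> s0 dphi phi'K.
have K0 : 0 <= K / s.
  rewrite divr_ge0 ?(ltW s0)//; have := phi'K 1 (lexx _).
  by rewrite powR1 mulr1; apply: le_trans.
have one_sided (psi psi' : R -> R) :
    (forall t, 1 <= t -> is_derive t (1 : R) psi (psi' t)) ->
    (forall t, 1 <= t -> - psi' t <= K * t `^ (s - 1)) ->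
    forall t, 1 <= t -> - psi t <= K / s * t `^ s + `|psi 1|.
  move=> dpsi psi'K t t1.
  pose F (x : R) := K / s * x `^ s + psi x.
  have dF (x : R) : 1 <= x -> is_derive x (1 : R) F (K * x `^ (s - 1) + psi' x).
    move=> x1; have x0 : 0 < x by apply: lt_le_trans x1.
    apply: (is_derive_eq (is_derive_addf (is_derive_mulf
      (is_derive_cstf (K / s) x) (is_derive1_powR s x0)) (dpsi x x1))).
    by rewrite mul0r addr0 mulrA divfK ?lt0r_neq0.
  have dF0 (x : R) : 1 <= x -> 0 <= K * x `^ (s - 1) + psi' x.
    by move=> /psi'K; lra.
  have := nondecreasing_of_derive dF dF0 (lexx 1) t1.
  by rewrite /F powR1 mulr1; have := ler_norm (- psi 1); rewrite normrN; lra.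
exists (K / s + `|phi 1|); first by rewrite addr_ge0.
move=> t t1.
have ts : 1 <= t `^ s by rewrite -[X in X <= _](powRr0 t) ler_powR// ltW.
apply: (@le_trans _ _ (K / s * t `^ s + `|phi 1|)); last first.
  by rewrite mulrDl lerD2l ler_peMr.
rewrite ler_norml lerNl; apply/andP; split.
  apply: (one_sided phi phi') => // x x1; apply: le_trans (phi'K x x1).
  by rewrite -normrN ler_norm.
have := one_sided (fun x => - phi x) (fun x => - phi' x) _ _ t t1.
rewrite opprK normrN; apply.
  by move=> x x1; exact: is_deriveN (dphi x x1).
by move=> x x1; rewrite opprK; apply: le_trans (phi'K x x1); rewrite ler_norm.
Qed.

End PowerGrowth.

(** Here h, f, q, g stand for 0F1, 1F2, 2F3, 3F4 at - t, and f1, q1, h1, h2 for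
derivatives: the asymptotics depend only on the differential equations that link
these functions, on h 0 = 1 and on the positivity of q. *)
Section Asymptotics.
Variables (R : realType) (a b : R) (h h1 h2 f f1 q q1 g : R -> R).
Hypothesis a0 : 0 < a.
Hypothesis b32 : 3 / 2 <= b.
Hypothesis dh : forall t, is_derive t (1 : R) h (h1 t).
Hypothesis dh1 : forall t, is_derive t (1 : R) h1 (h2 t).
Hypothesis ode : forall t, t * h2 t + b * h1 t = - h t.
Hypothesis h0 : h 0 = 1.
Hypothesis df : forall t, is_derive t (1 : R) f (f1 t).
Hypothesis fE : forall t, t * f1 t + a * f t = a * h t.
Hypothesis dq : forall t, is_derive t (1 : R) q (q1 t).
Hypothesis qE : forall t, t * (t * q1 t + a * q t) = a * b * (1 - h t).
Hypothesis gE : forall t, t * q1 t + 3 / 2 * q t = 3 / 2 * g t.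
Hypothesis q_gt0 : forall t, 0 < t -> 0 < q t.

Let p := Num.min 1 a.

Let p_gt0 : 0 < p. Proof. by rewrite lt_min ltr01. Qed.
Let p_le1 : p <= 1. Proof. by rewrite ge_min lexx. Qed.
Let p_lea : p <= a. Proof. by rewrite ge_min lexx orbT. Qed.

(** Since h = - (t h'' + b h'), integrating (t^a f)' = a t^(a-1) h by parts
moves t^a f to Phi = t^a (f + a h'), with Phi' = a (a - b) t^(a-1) h' of size
t^(a-2). Bounding h directly instead would lose a factor sqrt t. The exponent
3/4 p is a convenient one: any value strictly between p/2 and p gives
f^2 = o(t^(- p)) while leaving a positive power of t to integrate to. *)
Lemma F12_decay : exists2 K, 0 <= K &
  forall t, 1 <= t -> `|f t| <= K * t `^ (- (3 / 4 * p)).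
Proof.
pose s := a - 3 / 4 * p.
have s0 : 0 < s by rewrite /s; move: a0 p_lea; lra.
pose Phi (t : R) := t `^ a * f t + a * (t `^ a * h1 t).
have dPhi (t : R) : 1 <= t ->
    is_derive t (1 : R) Phi (a * (a - b) * (t `^ (a - 1) * h1 t)).
  move=> t1; have t0 : 0 < t by apply: lt_le_trans t1.
  have dp := is_derive1_powR a t0.
  apply: (is_derive_eq (is_derive_addf (is_derive_mulf dp (df t))
    (is_derive_mulf (is_derive_cstf a t) (is_derive_mulf dp (dh1 t))))).
  rewrite (powR_succ a t0) mul0r addr0; set x := t `^ (a - 1).
  have -> : t * x * f1 t + a * x * f t + a * (t * x * h2 t + a * x * h1 t)
    = x * ((t * f1 t + a * f t) + a * (t * h2 t) + a * a * h1 t) by ring.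
  have -> : t * h2 t = - h t - b * h1 t by rewrite -ode addrK.
  by rewrite fE; ring.
have th1 (t : R) : 1 <= t -> `|t `^ (a - 1) * h1 t| <= b * t `^ (s - 1).
  move=> t1; have t0 : 0 < t by apply: lt_le_trans t1.
  rewrite (powR_succ (a - 1) t0) mulrAC mulrC normrM.
  rewrite ger0_norm ?powR_ge0// mulrC.
  have th1b := bessel_derive_decay b32 dh dh1 ode h0 t1.
  rewrite ler_pM ?powR_ge0// ler_powR// /s; move: p_le1; lra.
have [|M M0 HM] := @derive_growth _ Phi _ s (`|a * (a - b)| * b) s0 dPhi.
  by move=> t t1; rewrite normrM -mulrA ler_wpM2l// th1.
have Mab : 0 <= M + a * b by rewrite addr_ge0// mulr_ge0 ?(ltW a0)//; move: b32; lra.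
exists (M + a * b) => // t t1.
have t0 : 0 < t by apply: lt_le_trans t1.
have ta : 0 < t `^ a by apply: powR_gt0.
rewrite -(ler_pM2l ta) mulrCA -powRD ?(gt_eqF t0) ?implybT//.
rewrite -[X in X * _](gtr0_norm ta) -normrM.
have -> : t `^ a * f t = Phi t - a * (t * (t `^ (a - 1) * h1 t)).
  by rewrite /Phi {3}(powR_succ a t0); ring.
apply: (le_trans (ler_normB _ _)); rewrite mulrDl lerD ?HM//.
rewrite normrM gtr0_norm// -[leRHS]mulrA -/s ler_pM2l// normrM gtr0_norm//.
by rewrite [t `^ s](powR_succ s t0) mulrCA ler_pM2l// th1.
Qed.

Let dY (t : R) : 0 < t -> is_derive t (1 : R) (fun x => x `^ a * q x)
  (a * b * (t `^ (a - 1 - 1) * (1 - h t))).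
Proof.
move=> t0.
apply: (is_derive_eq (is_derive_mulf (is_derive1_powR a t0) (dq t))).
rewrite (powR_succ a t0) (powR_succ (a - 1) t0).
by rewrite [RHS]mulrCA -qE; ring.
Qed.

Let powR_shift (c t : R) : 0 < t -> t `^ a * (c * t `^ (- p)) = c * t `^ (a - p).
Proof. by move=> t0; rewrite mulrCA -powRD ?(gt_eqF t0) ?implybT. Qed.

(** For c small, t^a q - c t^(a-p) is nondecreasing once |h| <= 1/2: its
derivative is t^(a-2) (a b (1 - h) - c (a - 1)) if a > 1, and the second term
disappears if a <= 1. Positivity of q at the starting point T fixes the other
constraint on c. *)
Lemma F23_lower : exists c T, [/\ 0 < c, 1 <= T &
  forall t, T <= t -> c * t `^ (- p) <= q t].
Proof.
have half0 : 0 < 2^-1 :> R by rewrite invr_gt0.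
have [T T1 hT] := bessel_small b32 dh dh1 ode h0 half0.
have T0 : 0 < T by apply: lt_le_trans T1.
pose c := Num.min (b / 2) (T `^ p * q T).
have c0 : 0 < c.
  rewrite lt_min divr_gt0//=; last by move: b32; lra.
  by rewrite mulr_gt0 ?powR_gt0 ?q_gt0.
have cb : c <= b / 2 by rewrite ge_min lexx.
have cT : c <= T `^ p * q T by rewrite ge_min lexx orbT.
exists c, T; split => // t Tt; have t0 : 0 < t by apply: lt_le_trans Tt.
pose F (x : R) := x `^ a * q x + (- c) * x `^ (a - p).
pose F' (x : R) := a * b * (x `^ (a - 1 - 1) * (1 - h x))
  + (- c) * ((a - p) * x `^ (a - p - 1)).
have dF (x : R) : T <= x -> is_derive x (1 : R) F (F' x).
  move=> Tx; have x0 : 0 < x by apply: lt_le_trans Tx.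
  apply: (is_derive_eq (is_derive_addf (dY x0) (is_derive_mulf
     (is_derive_cstf (- c) x) (is_derive1_powR (a - p) x0)))).
  by rewrite mul0r addr0.
have dF0 (x : R) : T <= x -> 0 <= F' x.
  move=> Tx; have := hT x Tx; rewrite ler_norml => /andP[_ hx].
  have x2 : 0 <= x `^ (a - 1 - 1) by apply: powR_ge0.
  have hx2 : 0 <= 1 - h x - 2^-1 by lra.
  have ab : 0 < a * b by rewrite mulr_gt0//; move: b32; lra.
  rewrite /F' /p; have [a1|a1] := leP a 1.
    rewrite subrr mul0r mulr0 addr0 !mulr_ge0//; [exact: ltW|by move: b32; lra|].
    by lra.
  set y := x `^ (a - 1 - 1).
  have -> : a * b * (y * (1 - h x)) + (- c) * ((a - 1) * y) =
    y * (a * b * (1 - h x) - c * (a - 1)) by ring.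
  rewrite mulr_ge0//.
  have := mulr_ge0 (ltW ab) hx2.
  have : 0 <= a * (b / 2 - c) by rewrite mulr_ge0 ?subr_ge0// ltW.
  by move: c0; lra.
have := nondecreasing_of_derive dF dF0 (lexx T) Tt.
rewrite -(ler_pM2l (powR_gt0 a t0)) powR_shift// => FTt.
have FT : 0 <= F T.
  rewrite /F {1}(_ : T `^ a = T `^ (a - p) * T `^ p); last first.
    by rewrite -powRD ?(gt_eqF T0) ?implybT// subrK.
  rewrite -mulrA mulNr [c * _]mulrC -mulrBr mulr_ge0 ?powR_ge0//.
  by rewrite subr_ge0.
by move: (le_trans FT FTt); rewrite /F; lra.
Qed.

(** Eliminating q' from the two equations for q gives
3 g = (3 - 2 a) q + 2 a b (1 - h) / t. If a <= 1 this is at least q. If a > 1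
the coefficient 3 - 2 a may be negative, and the two terms, both of order 1/t,
have to be compared: Z = (3 - 2 a) t^a q + (2 a b - c) t^(a-1) with
c = a b / (2 (a - 1)) is eventually nondecreasing, which leaves
3 g >= (c + o(1)) / t. *)
Lemma F34_lower : exists c T, [/\ 0 < c, 1 <= T &
  forall t, T <= t -> c * t `^ (- p) <= g t].
Proof.
have gq (t : R) : 0 < t -> 3 * g t * t = (3 - 2 * a) * q t * t + 2 * a * b * (1 - h t).
  by move=> t0; have := qE t; have := gE t; move=> /(congr1 (fun x => x * t)); lra.
have [a1|a1] := leP a 1.
  have [c [T1 [c0 T11 qT]]] := F23_lower.
  have [T2 T21 hT] := bessel_small b32 dh dh1 ode h0 (@ltr01 R).
  exists (c / 3), (T1 + T2); split; [by rewrite divr_gt0|lra|move=> t Tt].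
  have T1t : T1 <= t by lra.
  have T2t : T2 <= t by lra.
  have t0 : 0 < t by lra.
  rewrite mulrAC ler_pdivrMr//; apply: (le_trans (qT _ T1t)).
  rewrite -(ler_pM2r t0) [g t * 3]mulrC gq//.
  have := hT t T2t; rewrite ler_norml => /andP[_ hx].
  have H1 : 0 <= a * b * (1 - h t).
    by rewrite !mulr_ge0 ?subr_ge0 ?(ltW a0)//; move: b32; lra.
  have H2 : 0 <= (1 - a) * (q t * t).
    by rewrite !mulr_ge0 ?subr_ge0 ?(ltW (q_gt0 t0)) ?(ltW t0).
  by move: H1 H2; lra.
have ab : 0 < a * b by rewrite mulr_gt0//; move: b32; lra.
pose c := a * b / (2 * (a - 1)).
have c0 : 0 < c by rewrite divr_gt0// mulr_gt0// subr_gt0.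
have cE : c * (a - 1) = a * b / 2.
  by rewrite /c; field; move: a1; lra.
(* The first bound on h makes Z nondecreasing; the second makes the
   contribution 2 a b h / t at most half of c / t. *)
pose e := Num.min (2 * (`|3 - 2 * a| + 1))^-1 (c / (4 * (a * b))).
have e0 : 0 < e.
  rewrite lt_min invr_gt0 (divr_gt0 c0) ?andbT; last exact: mulr_gt0.
  by rewrite mulr_gt0// ltr_wpDl.
have [T1 T11 hT] := bessel_small b32 dh dh1 ode h0 e0.
have T10 : 0 < T1 by lra.
pose Z (x : R) := (3 - 2 * a) * (x `^ a * q x) + (2 * (a * b) - c) * x `^ (a - 1).
pose Z' (x : R) := a * b * x `^ (a - 1 - 1) * (2^-1 - (3 - 2 * a) * h x).
have dZ (x : R) : T1 <= x -> is_derive x (1 : R) Z (Z' x).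
  move=> Tx; have x0 : 0 < x by apply: lt_le_trans Tx.
  apply: (is_derive_eq (is_derive_addf
    (is_derive_mulf (is_derive_cstf (3 - 2 * a) x) (dY x0))
    (is_derive_mulf (is_derive_cstf (2 * (a * b) - c) x)
       (is_derive1_powR (a - 1) x0)))).
  have -> : (2 * (a * b) - c) * ((a - 1) * x `^ (a - 1 - 1)) =
    (2 * (a * b) * (a - 1) - c * (a - 1)) * x `^ (a - 1 - 1) by ring.
  by rewrite cE /Z'; field.
have dZ0 (x : R) : T1 <= x -> 0 <= Z' x.
  move=> Tx; rewrite /Z' mulr_ge0//; first by rewrite mulr_ge0 ?powR_ge0// ltW.
  rewrite subr_ge0; apply: (le_trans (ler_norm _)); rewrite normrM.
  have : `|h x| <= (2 * (`|3 - 2 * a| + 1))^-1.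
    by apply: (le_trans (hT x Tx)); rewrite ge_min lexx.
  have k0 : 0 <= `|3 - 2 * a| by apply: normr_ge0.
  move: k0; set k := `|3 - 2 * a| => k0 hx.
  apply: (le_trans (ler_wpM2l k0 hx)).
  rewrite invfM mulrCA ler_piMr// ?invr_ge0//.
  by rewrite ler_pdivrMr ?mul1r ?lerDl// ltr_wpDl.
have a10 : 0 < a - 1 by rewrite subr_gt0.
have [T2 T21 HT2] := powR_eventually_ge (`|Z T1| * (4 / c)) a10.
exists (c / 4 / 3), (T1 + T2); split; [by rewrite divr_gt0// divr_gt0|lra|move=> t Tt].
have T1t : T1 <= t by lra.
have T2t : T2 <= t by lra.
have t0 : 0 < t by lra.
have ta : 0 < t `^ (a - 1) by apply: powR_gt0.
have pE : p = 1 by rewrite /p; apply/min_idPl/ltW.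
rewrite pE mulrAC ler_pdivrMr// [g t * 3]mulrC -(ler_pM2r t0) gq//.
rewrite powR_inv1 ?(ltW t0)// divfK ?(gt_eqF t0)//.
rewrite -(ler_pM2r ta).
have -> : ((3 - 2 * a) * q t * t + 2 * a * b * (1 - h t)) * t `^ (a - 1) =
    Z t + t `^ (a - 1) * (c - 2 * (a * b) * h t).
  by rewrite /Z (powR_succ a t0); ring.
have Zt : - `|Z T1| <= Z t.
  apply: (@le_trans _ _ (Z T1)); first by rewrite lerNl -normrN ler_norm.
  exact: (nondecreasing_of_derive dZ dZ0).
have K1 : `|Z T1| * 4 <= t `^ (a - 1) * c.
  by rewrite -ler_pdivrMr// -mulrA HT2.
have K2 : (a * b) * h t <= c / 4.
  apply: (@le_trans _ _ (a * b * (c / (4 * (a * b))))).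
    rewrite ler_pM2l//; apply: (le_trans (ler_norm _)).
    by apply: (le_trans (hT t T1t)); rewrite ge_min lexx orbT.
  by rewrite invfM [4^-1 * _]mulrC mulrCA mulVKf ?gt_eqF.
have K3 : 0 <= t `^ (a - 1) * (c / 4 - (a * b) * h t).
  by rewrite mulr_ge0 ?(ltW ta)// subr_ge0.
by move: K1 K3 Zt; lra.
Qed.

(** Whatever the sign of l, the square of f is o(t^(- p)), hence negligible with
respect to g. *)
Lemma symbol_lower (m l : R) : 0 < m -> exists c T, [/\ 0 < c, 1 <= T &
  forall t, T <= t -> c * t `^ (- p) <= m * g t + l * f t ^+ 2].
Proof.
move=> m0; have [c [T1 [c0 T11 gT]]] := F34_lower.
have [K K0 fK] := F12_decay.
have p20 : 0 < p / 2 by rewrite divr_gt0.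
have [T2 T21 HT2] := powR_eventually_ge (`|l| * K ^+ 2 * (2 / (m * c))) p20.
have mc0 : 0 < m * c by rewrite mulr_gt0.
exists (m * c / 2), (T1 + T2); split; [by rewrite divr_gt0|lra|move=> t Tt].
have T1t : T1 <= t by lra.
have T2t : T2 <= t by lra.
have t1 : 1 <= t by lra.
have t0 : 0 < t by lra.
have H1 : m * (c * t `^ (- p)) <= m * g t by rewrite ler_pM2l// gT.
have H2 : `|l * f t ^+ 2| <= `|l| * K ^+ 2 * (t `^ (- p) * t `^ (- (p / 2))).
  rewrite normrM normrX -mulrA ler_wpM2l//.
  rewrite -powRD ?(gt_eqF t0) ?implybT//.
  have -> : - p + - (p / 2) = - (3 / 4 * p) * 2%:R by field.
  rewrite powRrM powR_mulrn ?powR_ge0// -exprMn.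
  by rewrite lerXn2r ?nnegrE// ?fK// mulr_ge0// powR_ge0.
have H3 : `|l| * K ^+ 2 * t `^ (- (p / 2)) <= m * c / 2.
  rewrite powRN ler_pdivrMr ?powR_gt0// [leRHS]mulrC -ler_pdivrMr ?divr_gt0//.
  by rewrite invf_div HT2.
have H4 : 0 <= t `^ (- p) * (m * c / 2 - `|l| * K ^+ 2 * t `^ (- (p / 2))).
  by rewrite mulr_ge0 ?powR_ge0// subr_ge0.
have := ler_norm (- (l * f t ^+ 2)); rewrite normrN.
by move: H1 H2 H4; lra.
Qed.

End Asymptotics.

(** * The symbols of the peridynamic operator *)

Section Coefficients.
Variable R : realType.
Implicit Types (a b x t : R) (A B : seq R) (c d : nat -> R) (m : nat).

Lemma poch0 a : poch a 0 = 1. Proof. by rewrite /poch big_ord0. Qed.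

Lemma pochSr a m : poch a m.+1 = poch a m * (a + m%:R).
Proof. by rewrite /poch big_ord_recr. Qed.

Lemma pochS a m : poch a m.+1 = a * poch (a + 1) m.
Proof.
rewrite /poch big_ord_recl/= addr0; congr (_ * _); apply: eq_bigr => i _.
by rewrite /bump/= add1n -natr1 addrCA addrC -addrA.
Qed.

Lemma poch_gt0 a m : 0 < a -> 0 < poch a m.
Proof. by move=> a0; apply: prodr_gt0 => i _; rewrite ltr_wpDr. Qed.

Lemma poch_ge1 a m : 1 <= a -> 1 <= poch a m.
Proof.
move=> a1; elim: m => [|m IH]; first by rewrite poch0.
by rewrite pochSr mulr_ege1// ler_wpDr.
Qed.

Lemma poch1 m : poch 1 m = m`!%:R :> R.
Proof.
elim: m => [|m IH]; first by rewrite poch0.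
by rewrite pochSr IH factS natrM nat1r mulrC.
Qed.

Lemma poch2 m : poch 2 m = m.+1`!%:R :> R.
Proof.
have := pochS (1 : R) m; rewrite mul1r poch1 => ->.
by congr poch; ring.
Qed.

Lemma poch_quot a m : 0 < a -> (m%:R + a) * (poch a m / poch (a + 1) m) = a.
Proof.
move=> a0; rewrite mulrA [_ + a]addrC [_ * poch a m]mulrC -pochSr pochS.
by rewrite mulfK// gt_eqF// poch_gt0// addr_gt0.
Qed.

(** The alternating sign is put in the coefficients so that all functions
become power series in t >= 0, although the multipliers evaluate the
hypergeometric functions at - t. *)
Definition alt_coeff A B m : R := (-1) ^+ m * hypergeom_coeff A B m.

Lemma hypergeomN A B t : hypergeom A B (- t) = psum (alt_coeff A B) t.
Proof.
rewrite /hypergeom /psum /pseries; congr (limn (series _)); apply/funext => m.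
by rewrite /alt_coeff exprNn mulrCA mulrA.
Qed.

Lemma alt_coeff0 A B : alt_coeff A B 0 = 1.
Proof.
rewrite /alt_coeff /hypergeom_coeff expr0 mul1r fact0 divr1.
by rewrite !big1 ?divr1// => ? _; rewrite poch0.
Qed.

End Coefficients.

Section Families.
Variables (R : realType) (a b : R).
Hypothesis a0 : 0 < a.
Hypothesis b1 : 1 <= b.
Let b0 : 0 < b. Proof. exact: lt_le_trans b1. Qed.

Definition F01_coeff : nat -> R := alt_coeff [::] [:: b].
Definition F12_coeff : nat -> R := alt_coeff [:: a] [:: b; a + 1].
Definition F23_coeff : nat -> R := alt_coeff [:: 1; a] [:: 2; b + 1; a + 1].
Definition F34_coeff : nat -> R :=
  alt_coeff [:: 1; 5 / 2; a] [:: 2; 3 / 2; b + 1; a + 1].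

Lemma F01_coeffE m : F01_coeff m = (-1) ^+ m / (poch b m * m`!%:R).
Proof.
by rewrite /F01_coeff /alt_coeff /hypergeom_coeff !big_cons !big_nil mulr1 mul1r invfM.
Qed.

Lemma F01_coeff_rec m : (m%:R + b) * pseries_diffs F01_coeff m = - F01_coeff m.
Proof.
have pb := poch_gt0 m b0.
rewrite /pseries_diffs !F01_coeffE pochSr factS natrM exprS.
have m1 : m.+1%:R != 0 :> R by rewrite pnatr_eq0.
have mf : m`!%:R != 0 :> R by rewrite pnatr_eq0 -lt0n fact_gt0.
have mb : b + m%:R != 0 by rewrite gt_eqF// ltr_wpDr.
by field; rewrite mf mb nat1r m1 gt_eqF.
Qed.

Lemma F12_coeff_rec m : (m%:R + a) * F12_coeff m = a * F01_coeff m.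
Proof.
rewrite F01_coeffE /F12_coeff /alt_coeff /hypergeom_coeff !big_cons !big_nil !mulr1.
rewrite -[in RHS](poch_quot m a0) !invfM; ring.
Qed.

Lemma F23_coeff_rec m : (m%:R + a) * F23_coeff m = - (a * b) * shift F01_coeff m.
Proof.
rewrite /shift F01_coeffE /F23_coeff /alt_coeff /hypergeom_coeff !big_cons !big_nil !mulr1.
rewrite poch1 poch2 -[X in - (X * b)](poch_quot m a0) pochS exprS !invfM.
have mf : m`!%:R != 0 :> R by rewrite pnatr_eq0 -lt0n fact_gt0.
by field; rewrite mf !gt_eqF// ?poch_gt0// ?addr_gt0.
Qed.

(** The quotient (5/2)_m / (3/2)_m is (m + 3/2) / (3/2): passing from 2F3 to
3F4 is a first order differential operator. *)
Lemma F34_coeff_rec m : (m%:R + 3 / 2) * F23_coeff m = 3 / 2 * F34_coeff m.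
Proof.
rewrite /F34_coeff /F23_coeff /alt_coeff /hypergeom_coeff !big_cons !big_nil !mulr1.
have -> : poch (5 / 2) m = poch (3 / 2) m * (m%:R + 3 / 2) / (3 / 2) :> R.
  have -> : 5 / 2 = 3 / 2 + 1 :> R by field.
  by rewrite [m%:R + _]addrC -pochSr pochS mulrAC mulfV ?mul1r// gt_eqF// divr_gt0.
have mf : m`!%:R != 0 :> R by rewrite pnatr_eq0 -lt0n fact_gt0.
by field; rewrite mf !gt_eqF// ?poch_gt0// ?addr_gt0// divr_gt0.
Qed.

Lemma fact_bounded_F01_coeff : fact_bounded F01_coeff.
Proof.
exists 1 => m; rewrite F01_coeffE normrM normrX normrN1 expr1n mul1r mul1r.
have m0 : 0 < m`!%:R :> R by rewrite ltr0n fact_gt0.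
rewrite normfV gtr0_norm ?mulr_gt0 ?poch_gt0//.
by rewrite lef_pV2 ?posrE ?mulr_gt0 ?poch_gt0// ler_peMl ?poch_ge1// ltW.
Qed.

Lemma fact_bounded_F12_coeff : fact_bounded F12_coeff.
Proof.
by apply: (fact_bounded_div a0 _ F12_coeff_rec); exact/fact_boundedZ/fact_bounded_F01_coeff.
Qed.

Lemma fact_bounded_F23_coeff : fact_bounded F23_coeff.
Proof.
apply: (fact_bounded_div a0 _ F23_coeff_rec).
exact/fact_boundedZ/fact_bounded_shift/fact_bounded_F01_coeff.
Qed.

(** The factor m + 3/2 is compared with m + a, for which the product with the
coefficients of 2F3 is already known. *)
Lemma fact_bounded_F34_coeff : fact_bounded F34_coeff.
Proof.
have -> : F34_coeff = fun m => 2 / 3 * (- (a * b) * shift F01_coeff m + (3 / 2 - a) * F23_coeff m).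
  apply/funext => m; rewrite -F23_coeff_rec -mulrDl.
  have -> : m%:R + a + (3 / 2 - a) = m%:R + 3 / 2 :> R by ring.
  by rewrite F34_coeff_rec; field.
apply/fact_boundedZ/fact_boundedD; apply: fact_boundedZ.
  exact/fact_bounded_shift/fact_bounded_F01_coeff.
exact: fact_bounded_F23_coeff.
Qed.

Lemma F01_ode t : t * psum (pseries_diffs (pseries_diffs F01_coeff)) t
  + b * psum (pseries_diffs F01_coeff) t = - psum F01_coeff t.
Proof.
have H := fact_bounded_F01_coeff.
rewrite (@psum_euler _ b _ (fun m => -1 * F01_coeff m)); last 3 first.
- exact: fact_bounded_diffs.
- exact: fact_boundedZ.
- by move=> m; rewrite F01_coeff_rec mulN1r.
by rewrite psumZ// mulN1r.
Qed.

Lemma F12_ode t :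
  t * psum (pseries_diffs F12_coeff) t + a * psum F12_coeff t = a * psum F01_coeff t.
Proof.
have H := fact_bounded_F01_coeff.
rewrite (@psum_euler _ a _ (fun m => a * F01_coeff m)) ?psumZ//.
- exact: fact_bounded_F12_coeff.
- exact: fact_boundedZ.
- exact: F12_coeff_rec.
Qed.

(** The right-hand side comes from t * sum_m h_(m+1) t^m = h(t) - 1. *)
Lemma F23_ode t : t * (t * psum (pseries_diffs F23_coeff) t + a * psum F23_coeff t)
  = a * b * (1 - psum F01_coeff t).
Proof.
have H := fact_bounded_F01_coeff; have H' := fact_bounded_shift H.
rewrite (@psum_euler _ a _ (fun m => - (a * b) * shift F01_coeff m)); last 3 first.
- exact: fact_bounded_F23_coeff.
- exact: fact_boundedZ.
- exact: F23_coeff_rec.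
by rewrite psumZ// (psum_shift t H) [F01_coeff 0]alt_coeff0; ring.
Qed.

Lemma F34_of_F23 t : t * psum (pseries_diffs F23_coeff) t + 3 / 2 * psum F23_coeff t
  = 3 / 2 * psum F34_coeff t.
Proof.
have H := fact_bounded_F34_coeff.
rewrite (@psum_euler _ (3 / 2) _ (fun m => 3 / 2 * F34_coeff m)) ?psumZ//.
- exact: fact_bounded_F23_coeff.
- exact: fact_boundedZ.
- exact: F34_coeff_rec.
Qed.

End Families.

Section Coercive.
Variable R : realType.

(** On the compact part the minimum of F is a bound, as (1 + t)^(- p) <= 1. *)
Lemma coercive_of_tail (F : R -> R) (p c T : R) : 0 < p -> continuous F ->
  (forall t, 0 <= t -> 0 < F t) -> 0 < c -> 1 <= T ->
  (forall t, T <= t -> c * t `^ (- p) <= F t) ->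
  exists2 c', 0 < c' & forall t, 0 <= t -> c' * (1 + t) `^ (- p) <= F t.
Proof.
move=> p0 cF F0 c0 T1 FT; have T0 : 0 <= T by apply: le_trans T1.
have [x x0T Fx] := EVT_min T0 (continuous_subspaceT cF).
have Fx0 : 0 < F x by apply: F0; rewrite (itvP x0T).
exists (Num.min (F x) c); first by rewrite lt_min Fx0.
move=> t t0; have [tT|tT] := leP t T.
  apply: (@le_trans _ _ (F x)); last by apply: Fx; rewrite in_itv/= t0.
  apply: (@le_trans _ _ (F x * 1)); last by rewrite mulr1.
  rewrite ler_pM ?powR_ge0//; first by rewrite le_min !ltW.
    by rewrite ge_min lexx.
  by rewrite -[leRHS](powRr0 (1 + t)) ler_powR ?lerDl// oppr_le0 ltW.
have t1 : 0 < t by apply: le_lt_trans tT.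
apply: le_trans (FT _ (ltW tT)).
rewrite ler_pM ?powR_ge0//; first by rewrite le_min !ltW.
  by rewrite ge_min lexx orbT.
rewrite !powRN lef_pV2 ?posrE ?powR_gt0 ?addr_gt0//.
by rewrite ge0_ler_powR ?nnegrE ?(ltW p0) ?(ltW t1) ?addr_ge0 ?lerDr.
Qed.

End Coercive.

Section Symbols.
Variables (R : realType) (a b mu l : R).
Hypothesis a0 : 0 < a.
Hypothesis b32 : 3 / 2 <= b.
Hypothesis mu0 : 0 < mu.

Let b1 : 1 <= b. Proof. by move: b32; lra. Qed.

(** With l = lams - mu and t = |nu|^2 delta^2 / 4, the eigenvalues are
lambda1(nu) = - |nu|^2 * longitudinal_symbol t and
lambda2(nu) = - |nu|^2 * transverse_symbol t. *)
Definition longitudinal_symbol (t : R) : R :=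
  3 * mu * psum (F34_coeff a b) t + l * psum (F12_coeff a b) t ^+ 2.

Definition transverse_symbol (t : R) : R := mu * psum (F23_coeff a b) t.

Lemma longitudinal_symbol0 : longitudinal_symbol 0 = 3 * mu + l.
Proof. by rewrite /longitudinal_symbol !psum0 /F34_coeff /F12_coeff !alt_coeff0 expr1n !mulr1. Qed.

Lemma transverse_symbol0 : transverse_symbol 0 = mu.
Proof. by rewrite /transverse_symbol psum0 /F23_coeff alt_coeff0 mulr1. Qed.

Lemma continuous_longitudinal_symbol : continuous longitudinal_symbol.
Proof.
move=> t; apply: cvgD; apply: cvgM; try exact: cvg_cst.
  exact: (continuous_psum (fact_bounded_F34_coeff a0 b1)).
by apply: cvgM; exact: (continuous_psum (fact_bounded_F12_coeff a0 b1)).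
Qed.

Lemma continuous_transverse_symbol : continuous transverse_symbol.
Proof.
move=> t; apply: cvgM; first exact: cvg_cst.
exact: (continuous_psum (fact_bounded_F23_coeff a0 b1)).
Qed.

(** Positivity at t = 0 is that of 3 mu + l = lams + 2 mu and of mu; positivity
of the second symbol is also what the asymptotics of 2F3 start from. *)
Lemma symbols_coercive :
  (forall t, 0 < t -> 0 < transverse_symbol t) ->
  (forall t, 0 < t -> 0 < longitudinal_symbol t) -> 0 < 3 * mu + l ->
  exists2 c, 0 < c & forall t, 0 <= t ->
    c * (1 + t) `^ (- Num.min 1 a) <= longitudinal_symbol t /\
    c * (1 + t) `^ (- Num.min 1 a) <= transverse_symbol t.
Proof.
move=> T_gt0 L_gt0 l_gt0; have p0 : 0 < Num.min 1 a by rewrite lt_min ltr01.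
have q_gt0 t : 0 < t -> 0 < psum (F23_coeff a b) t.
  by move=> /T_gt0; rewrite /transverse_symbol pmulr_rgt0.
have T_gt0' t : 0 <= t -> 0 < transverse_symbol t.
  rewrite le_eqVlt => /predU1P[<-|]; [by rewrite transverse_symbol0|exact: T_gt0].
have L_gt0' t : 0 <= t -> 0 < longitudinal_symbol t.
  rewrite le_eqVlt => /predU1P[<-|]; [by rewrite longitudinal_symbol0|exact: L_gt0].
have hb := fact_bounded_F01_coeff b1.
have e1 t := is_derive_psum t hb.
have e2 t := is_derive_psum t (fact_bounded_diffs hb).
have e3 := F01_ode b1.
have e4 : psum (F01_coeff b) 0 = 1 by rewrite psum0 [LHS]alt_coeff0.
have e5 t := is_derive_psum t (fact_bounded_F12_coeff a0 b1).
have e6 := F12_ode a0 b1.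
have e7 t := is_derive_psum t (fact_bounded_F23_coeff a0 b1).
have e8 := F23_ode a0 b1.
have e9 := F34_of_F23 a0 b1.
have [c1 [T1 [c10 T11 LT]]] : exists c T, [/\ 0 < c, 1 <= T & forall t, T <= t ->
    c * t `^ (- Num.min 1 a) <= longitudinal_symbol t].
  apply: (symbol_lower a0 b32 e1 e2 e3 e4 e5 e6 e7 e8 e9 q_gt0).
  by rewrite mulr_gt0.
have [c2 [T2 [c20 T21 TT]]] := F23_lower a0 b32 e1 e2 e3 e4 e7 e8 q_gt0.
have TT' t : T2 <= t -> mu * c2 * t `^ (- Num.min 1 a) <= transverse_symbol t.
  by move=> /TT; rewrite /transverse_symbol -mulrA ler_pM2l.
have [d1 d10 L1] := coercive_of_tail p0 continuous_longitudinal_symbol L_gt0' c10 T11 LT.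
have [d2 d20 L2] := coercive_of_tail p0 continuous_transverse_symbol T_gt0'
  (mulr_gt0 mu0 c20) T21 TT'.
exists (Num.min d1 d2) => [|t t0]; first by rewrite lt_min d10.
split; [apply: le_trans (L1 t t0)|apply: le_trans (L2 t t0)];
  by rewrite ler_wpM2r ?powR_ge0// ge_min lexx ?orbT.
Qed.

End Symbols.

(** * Matrices with a distinguished eigenvector *)

Section RealAndImaginaryParts.
Variables (R : realType) (n : nat).
Implicit Types (v : 'cV[R]_n) (w : 'cV[R[i]]_n) (A B : 'M[R]_n).

Lemma normsq_ge0 v : 0 <= normsq v.
Proof. by apply: sumr_ge0 => i _; rewrite sqr_ge0. Qed.

Lemma cnormsqE w :
  cnormsq w = normsq (map_mx (@complex.Re R) w) + normsq (map_mx (@complex.Im R) w).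
Proof.
by rewrite /cnormsq big_split; congr (_ + _); apply: eq_bigr => i _; rewrite !mxE.
Qed.

Lemma cnormsq_ge0 w : 0 <= cnormsq w.
Proof. by rewrite cnormsqE addr_ge0// normsq_ge0. Qed.

Lemma Re_real_cmx A w :
  map_mx (@complex.Re R) (real_cmx A *m w) = A *m map_mx (@complex.Re R) w.
Proof.
apply/colP => i; rewrite !mxE raddf_sum; apply: eq_bigr => j _.
by rewrite !mxE; case: (w j 0) => x y /=; rewrite mul0r subr0.
Qed.

Lemma Im_real_cmx A w :
  map_mx (@complex.Im R) (real_cmx A *m w) = A *m map_mx (@complex.Im R) w.
Proof.
apply/colP => i; rewrite !mxE raddf_sum; apply: eq_bigr => j _.
by rewrite !mxE; case: (w j 0) => x y /=; rewrite mul0r addr0.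
Qed.

Lemma real_cmxM A B : real_cmx (A *m B) = real_cmx A *m real_cmx B.
Proof. exact: (map_mxM (real_complex R)). Qed.

Lemma real_cmxB A B : real_cmx (A - B) = real_cmx A - real_cmx B.
Proof. exact: (map_mxB (real_complex R)). Qed.

Lemma real_cmx1 : real_cmx 1%:M = 1%:M :> 'M[R[i]]_n.
Proof. exact: (map_mx1 (real_complex R)). Qed.

End RealAndImaginaryParts.

Section SpectralMatrix.
Variables (R : realType) (n : nat) (nu : 'cV[R]_n).
Hypothesis nu0 : nu != 0.
Implicit Types (l m : R) (v : 'cV[R]_n).

(** The matrix with eigenvalue l on the line of nu and m on its orthogonal. Both
the peridynamic and the Navier multipliers have this form, and for a fixed nu
these matrices form an algebra isomorphic to R x R. *)
Definition spec l m : 'M[R]_n :=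
  m%:M + ((l - m) / normsq nu) *: (nu *m nu^T).

Lemma spec_trmx l m : (spec l m)^T = spec l m.
Proof. by rewrite /spec linearD linearZ /= tr_scalar_mx trmx_mul trmxK. Qed.

Lemma specM l m l' m' : spec l m *m spec l' m' = spec (l * l') (m * m').
Proof.
have N0 : normsq nu != 0 by rewrite normsq_eq0.
have PP : (nu *m nu^T) *m (nu *m nu^T) = normsq nu *: (nu *m nu^T).
  by rewrite mulmxA -(mulmxA nu) dot_normsq mul_mx_scalar scalemxAl.
rewrite /spec mulmxDl !mulmxDr mul_scalar_mx scale_scalar_mx -addrA.
congr (_ + _); rewrite mul_scalar_mx scalerA mul_mx_scalar scalerA.
rewrite -scalemxAl -scalemxAr PP !scalerA -!scalerDl; congr (_ *: _).
by field.
Qed.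

Lemma spec11 : spec 1 1 = 1%:M.
Proof. by rewrite /spec subrr mul0r scale0r addr0. Qed.

Lemma specB l m l' m' : spec l m - spec l' m' = spec (l - l') (m - m').
Proof.
rewrite /spec opprD addrACA -scalerBl raddfB/=; congr (_ + _ *: _); ring.
Qed.

Lemma spec_split l m : spec l m = l *: spec 1 0 + m *: spec 0 1.
Proof.
rewrite /spec !subr0 sub0r raddf0 add0r scalerDr !scalerA scale_scalar_mx mulr1.
rewrite addrCA -scalerDl; congr (_ + _ *: _); ring.
Qed.

(** Pythagoras for the two eigenspaces: spec 1 0 and spec 0 1 are the orthogonal
projections. *)
Lemma normsq_spec l m v :
  normsq (spec l m *m v) = l ^+ 2 * normsq (spec 1 0 *m v)
                         + m ^+ 2 * normsq (spec 0 1 *m v).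
Proof.
have E x y : normsq (spec x y *m v) = (v^T *m spec (x ^+ 2) (y ^+ 2) *m v) 0 0.
  have := dot_normsq (spec x y *m v).
  rewrite trmx_mul spec_trmx mulmxA -[_ *m _ *m spec x y]mulmxA specM -!expr2.
  by move=> ->; rewrite mxE mulr1n.
rewrite !E spec_split !expr1n !expr0n/= mulmxDr mulmxDl.
by rewrite -!scalemxAr -!scalemxAl !mxE.
Qed.

Lemma normsq_spec_le l m v :
  normsq (spec l m *m v) <= (l ^+ 2 + m ^+ 2) * normsq v.
Proof.
have := normsq_spec 1 1 v; rewrite spec11 mul1mx !expr1n !mul1r => ->.
rewrite normsq_spec.
have := mulr_ge0 (sqr_ge0 l) (normsq_ge0 (spec 0 1 *m v)).
have := mulr_ge0 (sqr_ge0 m) (normsq_ge0 (spec 1 0 *m v)).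
lra.
Qed.

Lemma cnormsq_spec_le l m (w : 'cV[R[i]]_n) :
  cnormsq (real_cmx (spec l m) *m w) <= (l ^+ 2 + m ^+ 2) * cnormsq w.
Proof.
by rewrite !cnormsqE Re_real_cmx Im_real_cmx mulrDr lerD// normsq_spec_le.
Qed.

Lemma spec_solve l m (w y : 'cV[R[i]]_n) : l != 0 -> m != 0 ->
  real_cmx (spec l m) *m w = y -> w = real_cmx (spec l^-1 m^-1) *m y.
Proof.
move=> l0 m0 <-; rewrite mulmxA -real_cmxM specM !mulVf// spec11 real_cmx1.
by rewrite mul1mx.
Qed.

(** The difference of two solutions is governed by the differences of the
inverse eigenvalues, because both matrices are diagonal in the same frame. *)
Lemma spec_solve_diff l m l' m' (w w' y : 'cV[R[i]]_n) :
  l != 0 -> m != 0 -> l' != 0 -> m' != 0 ->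
  real_cmx (spec l m) *m w = y -> real_cmx (spec l' m') *m w' = y ->
  cnormsq (w - w') <=
    ((l^-1 - l'^-1) ^+ 2 + (m^-1 - m'^-1) ^+ 2) * cnormsq y.
Proof.
move=> l0 m0 l'0 m'0 /(spec_solve l0 m0) -> /(spec_solve l'0 m'0) ->.
by rewrite -mulmxBl -real_cmxB specB cnormsq_spec_le.
Qed.

End SpectralMatrix.

(** * Dominated convergence for unordered sums *)

Section Dominated.
Context (R : realType) (I : choiceType) (T : Type) (F : set_system T) {FF : Filter F}.

(** A finite set A carries the sum of g up to e / 2; outside A the majorant
bounds the sum of f by e / 2, and on A the sum of f tends to 0. *)
Lemma esum_dominated (f : T -> I -> R) (g : I -> R) :
  (\forall x \near F, forall i, 0 <= f x i <= g i) ->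
  (\esum_(i in [set: I]) (g i)%:E < +oo)%E ->
  (forall i, f x i @[x --> F] --> (0 : R)) ->
  forall e : R, 0 < e ->
    \forall x \near F, (\esum_(i in [set: I]) (f x i)%:E <= e%:E)%E.
Proof.
move=> fg; case: (pselect (F set0)) => [F0 _ _ e _|F0].
  by apply: filterS F0.
have PF : ProperFilter F by split.
have g0 i : 0 <= g i.
  have [x /(_ i) /andP[f0 fgi]] := filter_ex fg.
  exact: le_trans fgi.
move=> gfin f_cvg e e0.
have e2 : 0 < e / 2 by rewrite divr_gt0.
have gE0 i : [set: I] i -> (0 <= (g i)%:E)%E by move=> _; rewrite lee_fin.
have gfin' : (\esum_(i in [set: I]) (g i)%:E)%E \is a fin_num.
  by rewrite ge0_fin_numE ?esum_ge0.
have [_ [A [Afin _] <-]] := ub_ereal_sup_adherent e2 gfin'.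
rewrite -/(esum _ _) => gA.
have gtail : (\esum_(i in ~` A) (g i)%:E <= (e / 2)%:E)%E.
  move: gA; rewrite (esumID A)// !setTI esum_fset//; last first.
    by move=> i _; rewrite lee_fin.
  rewrite fsumEFin// lteBlDr// lteD2lE//; exact: ltW.
have fhead : \forall x \near F, \sum_(i \in A) f x i < e / 2.
  have : \sum_(i <- finmap.enum_fset (fset_set A)) f x i @[x --> F] -->
      (\sum_(i <- finmap.enum_fset (fset_set A)) 0 : R).
    by apply: cvg_big => [|i _]; [exact: add_continuous|exact: f_cvg].
  rewrite big1// => /cvgr_lt /(_ _ e2); apply: filterS => x.
  by rewrite fsbig_finite.
apply: filterS2 fg fhead => x fgx fx.
have fE0 i : (0 <= (f x i)%:E)%E by rewrite lee_fin; case/andP: (fgx i).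
rewrite (esumID A)// !setTI (esum_fset Afin)// fsumEFin//.
rewrite [X in (_ <= X%:E)%E](splitr e) EFinD leeD//.
  by rewrite lee_fin ltW.
apply: le_trans gtail; apply: le_esum => i _.
by rewrite lee_fin; case/andP: (fgx i).
Qed.

Lemma sqrte_cvg0 (S : T -> \bar R) : (forall x, 0 <= S x)%E ->
  (forall e : R, 0 < e -> \forall x \near F, (S x <= e%:E)%E) ->
  sqrte (S x) @[x --> F] --> 0%E.
Proof.
move=> S0 Se.
have Sfin : \forall x \near F, S x \is a fin_num.
  apply: filterS (Se 1 ltr01) => x Sx.
  by rewrite ge0_fin_numE// (le_lt_trans Sx)// ltry.
apply/fine_cvgP; split.
  by apply: filterS Sfin => x; case: (S x).
apply/cvgrPdist_le => e e0.
have e20 : 0 < e ^+ 2 by rewrite exprn_gt0.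
apply: filterS2 (Se _ e20) Sfin => x.
rewrite /=; have := S0 x; case: (S x) => //= r; rewrite !lee_fin => r0 re _.
rewrite sub0r normrN ger0_norm ?sqrtr_ge0//.
apply: (@le_trans _ _ (Num.sqrt (e ^+ 2))); first exact: ler_wsqrtr.
by rewrite sqrtr_sqr gtr0_norm.
Qed.

End Dominated.

(** * Convergence of the solutions *)

Lemma esum_scale_lty (R : realType) (I : choiceType) (g : I -> R) (C : R) :
  0 <= C -> (forall i, 0 <= g i) ->
  (\esum_(i in [set: I]) (g i)%:E < +oo)%E ->
  (\esum_(i in [set: I]) (C * g i)%:E < +oo)%E.
Proof.
move=> C0 g0 gfin; set S := (esum _ _) in gfin.
have Sfin : S \is a fin_num.
  by rewrite ge0_fin_numE// esum_ge0// => i _; rewrite lee_fin.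
apply: (@le_lt_trans _ _ (C * fine S)%:E); last exact: ltry.
apply: ge_ereal_sup => /= _ [A [Afin AT] <-].
rewrite fsumEFin// fsbig_finite//= -mulr_sumr lee_fin ler_wpM2l//.
rewrite -lee_fin fineK//; apply: ereal_sup_ubound; exists A => //.
by rewrite fsumEFin// fsbig_finite.
Qed.

Section MultiplierSymbols.
Variables (R : realType) (n : nat) (mu lams beta : R).

Definition exponent_a : R := (n%:R + 2 - beta) / 2.
Definition bessel_b : R := (n%:R + 2) / 2.

Local Notation L := (longitudinal_symbol exponent_a bessel_b mu (lams - mu)).
Local Notation Tr := (transverse_symbol exponent_a bessel_b mu).

Lemma lambda1E delta (nu : 'cV[R]_n) : lambda1 mu lams delta beta nu =
  - normsq nu * L (4^-1 * normsq nu * delta ^+ 2).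
Proof.
rewrite /lambda1 /= !hypergeomN /longitudinal_symbol /F34_coeff /F12_coeff.
have -> : (n%:R + 4) / 2 = bessel_b + 1 by rewrite /bessel_b; field.
by have -> : (n%:R + 4 - beta) / 2 = exponent_a + 1 by rewrite /exponent_a; field.
Qed.

Lemma lambda2E delta (nu : 'cV[R]_n) : lambda2 mu delta beta nu =
  - normsq nu * Tr (4^-1 * normsq nu * delta ^+ 2).
Proof.
rewrite /lambda2 /= !hypergeomN /transverse_symbol /F23_coeff.
have -> : (n%:R + 4) / 2 = bessel_b + 1 by rewrite /bessel_b; field.
have -> : (n%:R + 4 - beta) / 2 = exponent_a + 1 by rewrite /exponent_a; field.
by ring.
Qed.

(** Unit vectors nu and all delta > 0 already reach every t > 0. *)
Lemma symbols_gt0 : (1 <= n)%N ->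
  (forall (delta : R) (nu : 'cV[R]_n), 0 < delta -> nu != 0 ->
     lambda1 mu lams delta beta nu < 0 /\ lambda2 mu delta beta nu < 0) ->
  forall t : R, 0 < t -> 0 < L t /\ 0 < Tr t.
Proof.
move=> n1 neg t t0.
pose nu : 'cV[R]_n := delta_mx (Ordinal n1) 0.
have N1 : normsq nu = 1.
  rewrite /normsq (bigD1 (Ordinal n1))//= big1 => [|j /negPf jn].
    by rewrite mxE !eqxx expr1n addr0.
  by rewrite mxE jn expr0n.
have nu0 : nu != 0 by rewrite -normsq_eq0 N1 oner_eq0.
have d0 : 0 < 2 * Num.sqrt t by rewrite mulr_gt0// sqrtr_gt0.
have := neg _ _ d0 nu0; rewrite lambda1E lambda2E N1.
have -> : 4^-1 * 1 * (2 * Num.sqrt t) ^+ 2 = t.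
  by rewrite exprMn sqr_sqrtr ?ltW//; field.
by rewrite !mulN1r !oppr_lt0.
Qed.

Lemma navier_multiplierE (k : 'cV[int]_n) : freq R k != 0 ->
  navier_multiplier mu lams k =
  spec (freq R k) (- normsq (freq R k) * (lams + 2 * mu))
                  (- normsq (freq R k) * mu).
Proof.
move=> k0; rewrite /navier_multiplier /spec addrC -raddfN/=.
rewrite -[X in _ + X]scaleNr; congr (_%:M + _ *: _); first by ring.
by field; rewrite normsq_eq0.
Qed.

Lemma freq_eq0 (k : 'cV[int]_n) : (freq R k == 0) = (k == 0).
Proof.
apply/eqP/eqP => [/colP h|->]; last by rewrite /freq map_mx0.
by apply/colP => i; have := h i; rewrite !mxE => /eqP; rewrite intr_eq0 => /eqP.
Qed.

Lemma normsq_freq_ge1 (k : 'cV[int]_n) : k != 0 -> 1 <= normsq (freq R k).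
Proof.
move=> k0; have [i ki] : exists i, k i 0 != 0.
  apply/existsP; rewrite -negb_forall; apply: contra k0 => /forallP h.
  by apply/eqP/colP => i; rewrite mxE; apply/eqP/h.
rewrite /normsq (bigD1 i)//= -[leLHS]addr0 lerD//; last first.
  by apply: sumr_ge0 => j _; exact: sqr_ge0.
rewrite mxE -rmorphXn/= -[1]/(1%:~R) ler_int.
by rewrite -gtz0_ge1 lt0r sqr_ge0 sqrf_eq0 ki.
Qed.

End MultiplierSymbols.

(** This is where the loss of ellipticity is converted into Sobolev exponents:
1 / (N F) <= (1 + N)^p / (c N), and N >= (1 + N) / 2. *)
Lemma inv_symbol_bound (R : realType) (N t F c p : R) : 1 <= N -> t <= N ->
  0 <= t -> 0 < p -> 0 < c -> c * (1 + t) `^ (- p) <= F ->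
  `|(- N * F)^-1| <= 2 / c * (1 + N) `^ (p - 1).
Proof.
move=> N1 tN t0 p0 c0 cF.
have N0 : 0 < N by apply: lt_le_trans N1.
have N10 : 0 < 1 + N by rewrite addr_gt0.
have cN : c * (1 + N) `^ (- p) <= F.
  apply: le_trans cF; rewrite ler_pM2l// !powRN lef_pV2 ?posrE ?powR_gt0//.
    by rewrite ge0_ler_powR ?nnegrE ?(ltW p0) ?(ltW N10) ?addr_ge0// lerD2l.
  by rewrite ltr_wpDr.
have F0 : 0 < F by apply: lt_le_trans cN; rewrite mulr_gt0 ?powR_gt0.
rewrite mulNr invrN normrN gtr0_norm ?invr_gt0 ?mulr_gt0//.
rewrite -[leLHS]mul1r ler_pdivrMr ?mulr_gt0//.
have B0 : 0 <= 2 / c * (1 + N) `^ (p - 1) * N.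
  by rewrite !mulr_ge0 ?powR_ge0 ?invr_ge0 ?ltW.
rewrite mulrA; apply: le_trans (ler_wpM2l B0 cN).
have -> : 2 / c * (1 + N) `^ (p - 1) * N * (c * (1 + N) `^ (- p)) =
    2 * N * ((1 + N) `^ (p - 1) * (1 + N) `^ (- p)).
  by field; rewrite gt_eqF.
rewrite -powRD ?(gt_eqF N10) ?implybT//.
have -> : p - 1 + - p = -1 by ring.
rewrite powR_inv1 ?(ltW N10)// ler_pdivlMr// mul1r.
by lra.
Qed.

Section Convergence.
Variables (R : realType) (n : nat) (beta mu lams s : R).
Variables (b uN : fourier_vector R n) (u : R -> fourier_vector R n).
Hypothesis n1 : (1 <= n)%N.
Hypothesis beta_lt : beta < n%:R + 2.
Hypothesis mu0 : 0 < mu.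
Hypothesis lame0 : 0 < lams + 2 * mu.
Hypothesis neg : forall (delta : R) (nu : 'cV[R]_n), 0 < delta -> nu != 0 ->
     lambda1 mu lams delta beta nu < 0 /\ lambda2 mu delta beta nu < 0.
Hypothesis navier_eq : navier mu lams uN = b.
Hypothesis uN0 : uN 0 = 0.
Hypothesis peri_eq : forall delta : R, 0 < delta ->
  peridynamic mu lams delta beta (u delta) = b.
Hypothesis u0 : forall delta : R, 0 < delta -> u delta 0 = 0.

Local Notation a := (exponent_a n beta).
Local Notation bb := (bessel_b R n).
Local Notation L := (longitudinal_symbol a bb mu (lams - mu)).
Local Notation Tr := (transverse_symbol a bb mu).
Local Notation N k := (normsq (freq R k)).
Local Notation p := (Num.min 1 a).

Let a0 : 0 < a.
Proof. by rewrite /exponent_a divr_gt0// subr_gt0. Qed.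

Let b32 : 3 / 2 <= bb.
Proof.
rewrite /bessel_b ler_pM2r ?invr_gt0//.
have : 1%:R <= n%:R :> R by rewrite ler_nat.
by lra.
Qed.

(** The squared distance of the inverse eigenvalues of the two operators at the
mode k; the Navier eigenvalues are the values of the symbols at t = 0. *)
Definition gap (k : 'cV[int]_n) (delta : R) : R :=
  let t := 4^-1 * N k * delta ^+ 2 in
  ((- N k * L t)^-1 - (- N k * L 0)^-1) ^+ 2
  + ((- N k * Tr t)^-1 - (- N k * Tr 0)^-1) ^+ 2.

Let L0 : L 0 = lams + 2 * mu.
Proof. by rewrite longitudinal_symbol0; ring. Qed.

Let Tr0 : Tr 0 = mu. Proof. exact: transverse_symbol0. Qed.

Lemma diff_le_gap k delta : 0 < delta -> k != 0 ->
  cnormsq ((u delta - uN) k) <= gap k delta * cnormsq (b k).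
Proof.
move=> d0 k0; have nu0 : freq R k != 0 by rewrite freq_eq0.
have N0 : 0 < N k by apply: lt_le_trans (normsq_freq_ge1 R k0).
have t0 : 0 < 4^-1 * N k * delta ^+ 2 by rewrite !mulr_gt0 ?exprn_gt0.
have [Lt Tt] := symbols_gt0 n1 neg t0.
have nz x : 0 < x -> - N k * x != 0.
  by move=> x0; rewrite mulNr oppr_eq0 mulf_neq0// gt_eqF.
apply: (spec_solve_diff nu0); rewrite ?nz ?L0 ?Tr0//.
  have := congr1 (fun v => v k) (peri_eq d0); rewrite /peridynamic.
  by rewrite peri_multiplierE /peri_multiplier_formula lambda1E lambda2E.
have := congr1 (fun v => v k) navier_eq; rewrite navierE navier_multiplierE//.
Qed.

Lemma gap_cvg0 k : gap k delta @[delta --> 0^'+] --> (0 : R).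
Proof.
have [->|k0] := eqVneq k 0.
  rewrite /gap (_ : N 0 = 0); last by apply/eqP; rewrite normsq_eq0 freq_eq0.
  under eq_fun do rewrite !oppr0 !mul0r !invr0 !subrr !expr0n/= addr0.
  exact: cvg_cst.
have N0 : 0 < N k by apply: lt_le_trans (normsq_freq_ge1 R k0).
have t_cvg : 4^-1 * N k * delta ^+ 2 @[delta --> 0^'+] --> (0 : R).
  rewrite [X in _ --> X](_ : 0 = 4^-1 * N k * 0 ^+ 2); last first.
    by rewrite expr0n mulr0.
  apply: cvgM; first exact: cvg_cst.
  by apply: cvg_at_right_filter; exact: exprn_continuous.
have part (S : R -> R) : continuous S -> 0 < S 0 ->
    ((- N k * S (4^-1 * N k * delta ^+ 2))^-1 - (- N k * S 0)^-1) ^+ 2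
      @[delta --> 0^'+] --> (0 : R).
  move=> cS S0.
  have H : (- N k * S (4^-1 * N k * delta ^+ 2))^-1 - (- N k * S 0)^-1
      @[delta --> 0^'+] --> (0 : R).
    rewrite -[X in _ --> X](subrr (- N k * S 0)^-1).
    apply: cvgB; last exact: cvg_cst.
    apply: cvgV; first by rewrite mulNr oppr_eq0 mulf_neq0// gt_eqF.
    apply: cvgM; first exact: cvg_cst.
    exact: (cvg_comp _ _ t_cvg (cS 0)).
  rewrite [X in _ --> X](_ : 0 = 0 ^+ 2); last by rewrite expr0n.
  exact: (cvg_comp _ _ H (@exprn_continuous _ 2 0)).
have b1 : 1 <= bb by move: b32; lra.
rewrite -[X in _ --> X]addr0; apply: cvgD; apply: part.
- exact: continuous_longitudinal_symbol.
- by rewrite L0.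
- exact: continuous_transverse_symbol.
- by rewrite Tr0.
Qed.

(** Both inverse eigenvalues are bounded by the same quantity B, of order
(1 + |k|^2)^(p - 1): the Navier one is the case t = 0. For delta <= 1 one has
t <= |k|^2, so B does not depend on delta. *)
Lemma gap_bounded : exists2 C, 0 <= C & forall k delta, k != 0 ->
  0 < delta -> delta <= 1 ->
  gap k delta <= C * (1 + N k) `^ (- Num.max 0 (beta - n%:R)).
Proof.
have Tpos t : 0 < t -> 0 < Tr t by move=> /(symbols_gt0 n1 neg) [].
have Lpos t : 0 < t -> 0 < L t by move=> /(symbols_gt0 n1 neg) [].
have l0 : 0 < 3 * mu + (lams - mu) by move: lame0; lra.
have [c c0 low] := symbols_coercive a0 b32 mu0 Tpos Lpos l0.
exists (2 * (4 / c) ^+ 2) => [|k delta k0 d0 d1].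
  by rewrite mulr_ge0 ?sqr_ge0.
have N1 := normsq_freq_ge1 R k0.
have N0 : 0 <= N k by apply: le_trans N1.
have p0 : 0 < p by rewrite lt_min ltr01.
pose B := 2 / c * (1 + N k) `^ (p - 1).
have d2 : delta ^+ 2 <= 1 by rewrite expr_le1// ltW.
have t0 : 0 <= 4^-1 * N k * delta ^+ 2.
  by rewrite mulr_ge0 ?sqr_ge0// mulr_ge0 ?invr_ge0.
have tN : 4^-1 * N k * delta ^+ 2 <= N k.
  have : N k * delta ^+ 2 <= N k by rewrite ler_piMr.
  by move: N1; lra.
have [Lt Tt] := low _ t0; have [L00 T00] := low _ (lexx 0).
have sq (x y : R) : `|x| <= B -> `|y| <= B -> (x - y) ^+ 2 <= (2 * B) ^+ 2.
  move=> xB yB; rewrite -real_normK ?num_real// lerXn2r ?nnegrE//.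
    by rewrite mulr_ge0// (le_trans _ xB).
  by apply: (le_trans (ler_normB _ _)); lra.
(* The identity 2 (p - 1) = - max(0, beta - n). *)
have BE : B ^+ 2 = (2 / c) ^+ 2 * (1 + N k) `^ (- Num.max 0 (beta - n%:R)).
  rewrite /B exprMn -[X in _ * X = _]powR_mulrn ?powR_ge0// -powRrM; congr (_ * _ `^ _).
  rewrite /exponent_a; have [h|h] := leP 1 ((n%:R + 2 - beta) / 2);
    have [h'|h'] := leP 0 (beta - n%:R); lra.
apply: (@le_trans _ _ ((2 * B) ^+ 2 + (2 * B) ^+ 2)); last first.
  by rewrite exprMn BE !exprMn; lra.
have bd (t F : R) : 0 <= t -> t <= N k -> c * (1 + t) `^ (- p) <= F ->
    `|(- N k * F)^-1| <= B.
  by move=> ? ? ?; apply: (@inv_symbol_bound _ _ t).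
by rewrite /gap lerD// sq//; [exact: bd Lt|exact: bd L00|exact: bd Tt|exact: bd T00].
Qed.

(** The weight (1 + |k|^2)^s' of the target norm times the bound on [gap] is
C (1 + |k|^2)^s, so the H^s norm of b provides the summable majorant. *)
Lemma sobolev_diff_cvg0 : sobolev s b ->
  sobolev_norm (s + Num.max 0 (beta - n%:R)) (u delta - uN)
    @[delta --> 0^'+] --> 0%E.
Proof.
move=> [_ bs]; have [C C0 gapC] := gap_bounded.
pose w (k : 'cV[int]_n) := (1 + N k) `^ (s + Num.max 0 (beta - n%:R)).
have N10 (k : 'cV[int]_n) : 0 < 1 + N k by rewrite ltr_wpDr ?normsq_ge0.
have wb0 (k : 'cV[int]_n) : 0 <= (1 + N k) `^ s * cnormsq (b k).
  by rewrite mulr_ge0 ?powR_ge0 ?cnormsq_ge0.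
have d00 delta : 0 < delta -> (u delta - uN) 0 = 0.
  by move=> d0; rewrite !fctE u0// uN0 subrr.
have c00 : cnormsq (0 : 'cV[R[i]]_n) = 0.
  by rewrite /cnormsq big1// => i _; rewrite mxE /= expr0n addr0.
apply: sqrte_cvg0 => [delta|].
  by apply: esum_ge0 => k _; rewrite lee_fin mulr_ge0 ?powR_ge0 ?cnormsq_ge0.
pose f (delta : R) (k : 'cV[int]_n) := w k * cnormsq ((u delta - uN) k).
pose g (k : 'cV[int]_n) := C * ((1 + N k) `^ s * cnormsq (b k)).
suff H : forall e : R, 0 < e -> \forall delta \near 0^'+,
  (\esum_(k in [set: 'cV[int]_n]) (f delta k)%:E <= e%:E)%E by exact: H.
apply: (@esum_dominated _ _ _ _ _ f g); rewrite /f /g.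
- near=> delta => k.
  have d0 : 0 < delta by near: delta; exact: nbhs_right_gt.
  have d1 : delta <= 1 by near: delta; exact: nbhs_right_le.
  rewrite mulr_ge0 ?powR_ge0 ?cnormsq_ge0//=.
  have [->|k0] := eqVneq k 0.
    by rewrite d00// c00 mulr0 mulr_ge0.
  apply: (le_trans (ler_wpM2l (powR_ge0 _ _) (diff_le_gap d0 k0))).
  rewrite mulrA mulrA ler_wpM2r ?cnormsq_ge0//.
  apply: (le_trans (ler_wpM2l (powR_ge0 _ _) (gapC k delta k0 d0 d1))).
  by rewrite mulrCA -powRD ?(gt_eqF (N10 k)) ?implybT// addrK.
- apply: esum_scale_lty => //.
  move: bs; rewrite /sobolev_norm.
  set S := esum _ _; have : (0 <= S)%E by apply: esum_ge0 => k _; rewrite lee_fin.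
  by case: S => //= r _ _; rewrite ltry.
- move=> k; have [->|k0] := eqVneq k 0.
    apply: cvg_near_cst; near=> delta.
    by rewrite d00 ?c00 ?mulr0.
  apply: (@squeeze_cvgr _ _ _ _ (fun=> 0) (fun delta => w k * (gap k delta * cnormsq (b k)))).
  + near=> delta.
    have d0 : 0 < delta by near: delta; exact: nbhs_right_gt.
    by rewrite mulr_ge0 ?powR_ge0 ?cnormsq_ge0//= ler_wpM2l ?powR_ge0 ?diff_le_gap.
  + exact: cvg_cst.
  + rewrite -[X in _ --> X](mulr0 (w k)) -[X in _ * X](mul0r (cnormsq (b k))).
    apply: cvgM; first exact: cvg_cst.
    by apply: cvgM; [exact: gap_cvg0|exact: cvg_cst].
Unshelve. all: by end_near. Qed.

End Convergence.

Theorem theorem14 (R : realType) (n : nat) (beta mu lams s : R)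
    (b uN : fourier_vector R n) (u : R -> fourier_vector R n) :
  (1 <= n)%N -> beta < n%:R + 2 ->
  0 < mu -> 0 < lams + 2 * mu ->
  (forall (delta : R) (nu : 'cV[R]_n), 0 < delta -> nu != 0 ->
     lambda1 mu lams delta beta nu < 0 /\ lambda2 mu delta beta nu < 0) ->
  let s' := s + Num.max 0 (beta - n%:R) in
  sobolev s b -> b 0 = 0 ->
  sobolev (s + 2) uN -> navier mu lams uN = b -> uN 0 = 0 ->
  (forall delta : R, 0 < delta ->
     [/\ sobolev s' (u delta),
         peridynamic mu lams delta beta (u delta) = b
       & u delta 0 = 0]) ->
  sobolev_norm s' (u delta - uN) @[delta --> 0^'+] --> 0%E.
Proof.
move=> n1 beta_lt mu0 lame0 neg s' hb _ _ navier_eq uN0 hu.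
by apply: (sobolev_diff_cvg0 n1 beta_lt mu0 lame0 neg navier_eq uN0 _ _ hb) => d d0;
  case: (hu d d0).
Qed.
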